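(* Let $n\ge 2$ and $k\ge 1$ be integers and let $w\in S_n$. In type $A_{n-1}$, the coefficient of $w$ in $x_k$ is equal to each of the following four quantities. (1) $\frac{1}{k^{n-1}}$ multiplied by the number of partitions with at most $n-1$ parts, each of size at most $k-cd(w)$, such that the total number being partitioned is congruent to $-maj(w)$ modulo $n$. (2) $\frac{1}{k^{n-1}}$ multiplied by the number of partitions with at most $k-cd(w)$ parts, each of size at most $n-1$, such that the total number being partitioned is congruent to $-maj(w)$ modulo $n$. (3) The quantity $$\begin{array}{ll} \frac{1}{n k^{n-1}} \sum_{d\mid n,\ d\mid k-cd(w)} \binom{\frac{n+k-cd(w)-d}{d}}{\frac{k-cd(w)}{d}} C_d(-maj(w)) & \text{if } k-cd(w)>0,\\ \frac{1}{k^{n-1}} & \text{if } k-cd(w)=0 \text{ and } maj(w)\equiv 0 \bmod n,\\ 0 & \text{otherwise.}\end{array}$$ (4) $\frac{1}{k^{n-1}} \sum_{r=0}^{\infty}$ of the coefficient of $q^{rn}$ in the polynomial $q^{maj(w)} {k+n-cd(w)-1 \brack n-1}$.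
   Context: For $w\in S_n$, $cd(w)$ is the number of cyclic descents: the number of $i\in\{1,\dots,n-1\}$ with $w(i)>w(i+1)$, plus $1$ if $w(n)>w(1)$. The major index is $maj(w)=\sum_{1\le i\le n-1,\ w(i)>w(i+1)} i$. For a positive integer $k$, the element $x_k$ (Cellini's element in type $A_{n-1}$) of the rational group algebra of $S_n$ is defined by: the coefficient of $w$ in $x_k$ is $\frac{1}{k^{n-1}}$ times the number of integer vectors $(v_1,\dots,v_n)$ such that (i) $v_1+\dots+v_n=0$; (ii) $v_1\ge v_2\ge\dots\ge v_n$ and $v_1-v_n\le k$; (iii) $v_i>v_{i+1}$ whenever $1\le i\le n-1$ and $w(i)>w(i+1)$; (iv) $v_1<v_n+k$ if $w(n)>w(1)$. $C_m(a)$ denotes the Ramanujan sum $\sum_{l} e^{2\pi i l a/m}$, over $1\le l\le m$ with $\gcd(l,m)=1$. ${a\brack b}=\frac{(1-q)\cdots(1-q^a)}{(1-q)\cdots(1-q^b)(1-q)\cdots(1-q^{a-b})}$ is the $q$-binomial coefficient in an indeterminate $q$, which is $0$ when $a<b$. Partitions may be empty (total $0$). When $k-cd(w)<0$ the counts in (1) and (2) are $0$. *)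

(* Defs.v *)
From HB Require Import structures.
From mathcomp Require Import all_boot all_order all_algebra all_fingroup.
From mathcomp Require Import finmap.
From mathcomp Require Import all_classical reals trigo.
From mathcomp Require Import complex.
From mathcomp Require Import zify ring.

Set Implicit Arguments.
Unset Strict Implicit.
Unset Printing Implicit Defensive.

Import Order.TTheory GRing.Theory Num.Theory.

Local Open Scope classical_set_scope.
Local Open Scope ring_scope.

(* Permutations act on {0, ..., n-1}: the index i : 'I_n stands for position
   i + 1.  [ordS] is the cyclic successor on 'I_n, so that position n is
   followed by position 1. *)

Definition cyc_desc n (w : 'S_n) (i : 'I_n) : bool := (w (ordS i) < w i)%N.

Definition cd n (w : 'S_n) : nat := #|[set i : 'I_n | cyc_desc w i]%SET|.

Definition maj n (w : 'S_n) : nat :=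
  \sum_(i < n | (i.+1 < n)%N && cyc_desc w i) i.+1.

(* In the second and fourth lines [v i] is v_n and [v (ordS i)] is v_1. *)
Definition cellini_vectors n (k : nat) (w : 'S_n) : set {ffun 'I_n -> int} :=
  [set v : {ffun 'I_n -> int} | \sum_i v i = 0
    /\ [/\ forall i : 'I_n, (i.+1 < n)%N -> v (ordS i) <= v i,
           forall i : 'I_n, i.+1 = n -> v (ordS i) - v i <= k%:Z,
           forall i : 'I_n, (i.+1 < n)%N -> cyc_desc w i -> v (ordS i) < v i
         & forall i : 'I_n, i.+1 = n -> cyc_desc w i -> v (ordS i) < v i + k%:Z]].

(* An element of the group algebra Q[S_n] is given by its coefficients. The
   set being counted is finite, see [finite_cellini_vectors], so [fset_set]
   does not take its default value. *)
Definition cellini n (k : nat) : {ffun 'S_n -> rat} :=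
  [ffun w : 'S_n => (k%:R ^+ n.-1)^-1 * #|` fset_set (cellini_vectors k w)|%:R].

Definition partitions_in_box (a b : nat) : set (seq nat) :=
  [set s | [/\ sorted geq s, all (ltn 0) s, (size s <= a)%N
             & all (fun part => part <= b)%N s]].

(* The partitions in the a x b box whose total is congruent to c modulo n. *)
Definition count_partitions (a b n : nat) (c : int) : nat :=
  #|` fset_set [set s | partitions_in_box a b s
                        /\ ((sumn s)%:Z = c %[mod n%:Z])%Z]|.

Definition expi (R : realType) (t : R) : R[i] := (cos t +i* sin t)%C.

Definition ramanujan_sum (R : realType) (m : nat) (a : int) : R[i] :=
  \sum_(1 <= l < m.+1 | coprime l m) expi (2 * pi * l%:R * a%:~R / m%:R : R).

Definition qpoch (a : nat) : {poly rat} := \prod_(1 <= i < a.+1) (1 - 'X^i).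

(* The Euclidean quotient is the quotient of the q-factorials: the division is
   exact, see [qbinomE]. *)
Definition qbinom (a b : nat) : {poly rat} :=
  if (a < b)%N then 0 else qpoch a %/ (qpoch b * qpoch (a - b)).

Lemma finite_cellini_vectors n k (w : 'S_n) :
  finite_set (cellini_vectors k w).
Proof.
pose f (u : {ffun 'I_n -> 'I_(2 * k).+1}) : {ffun 'I_n -> int} :=
  [ffun i => (u i)%:Z - k%:Z].
apply: (@sub_finite_set _ _ (f @` [set: _])); last first.
  exact/finite_image/finite_finset.
move=> v [sum0 [dec wid _ _]].
suff bnd i : - k%:Z <= v i <= k%:Z.
  exists [ffun i => inord (absz (v i + k%:Z))] => //.
  apply/ffunP => i; rewrite !ffunE; have /andP[lo hi] := bnd i.
  have ge0 : 0 <= v i + k%:Z by lia.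
  have absE := gez0_abs ge0.
  by rewrite inordK ?absE ?addrK//; lia.
case: n {w f} v sum0 dec wid i => [|m] v sum0 dec wid i; first by case: i.
have ordSE (j : 'I_m.+1) (hj : (j.+1 < m.+1)%N) : ordS j = Ordinal hj.
  by apply: val_inj; rewrite /= modn_small.
have mono (d : nat) (j l : 'I_m.+1) : (l = j + d :> nat)%N -> v l <= v j.
  elim: d l => [|d IHd] l lE.
    by rewrite (_ : l = j)//; apply: val_inj => /=; lia.
  have hjd : (j + d < m.+1)%N by have := ltn_ord l; lia.
  have hl : ((Ordinal hjd).+1 < m.+1)%N by have := ltn_ord l; rewrite /=; lia.
  apply: le_trans (IHd (Ordinal hjd) erefl).
  have := dec (Ordinal hjd) hl; rewrite (_ : ordS _ = l)//.
  by rewrite ordSE; apply: val_inj => /=; lia.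
have le0 j : v j <= v ord0 by apply: (mono j); rewrite add0n.
have lem j : v ord_max <= v j.
  by apply: (mono (m - j)%N); rewrite subnKC// -ltnS ltn_ord.
have wid0 : v ord0 - v ord_max <= k%:Z.
  have := wid ord_max erefl; rewrite (_ : ordS _ = ord0)//.
  by apply: val_inj; rewrite /= modnn.
have v0 : 0 <= v ord0.
  rewrite leNgt; apply/negP => v0_lt0; move/eqP: sum0; apply/negP/ltr0_neq0.
  rewrite big_ord_recl ltr_wnDr// sumr_le0// => j _.
  exact: le_trans (le0 _) (ltW v0_lt0).
have vm : v ord_max <= 0.
  rewrite leNgt; apply/negP => vm_gt0; move/eqP: sum0; apply/negP/lt0r_neq0.
  rewrite big_ord_recr ltr_wpDl// sumr_ge0// => j _.
  exact: le_trans (ltW vm_gt0) (lem _).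
by have := le0 i; have := lem i; lia.
Qed.

Lemma finite_partitions_in_box a b : finite_set (partitions_in_box a b).
Proof.
pose f (u : a.-bseq 'I_b.+1) : seq nat := map val u.
apply: (@sub_finite_set _ _ (f @` [set: _])); last first.
  exact/finite_image/finite_finset.
move=> s [_ _ sz /allP le_b].
have hs : (size [seq inord i : 'I_b.+1 | i <- s] <= a)%N by rewrite size_map.
exists (Bseq hs) => //; rewrite /f /= -map_comp map_id_in// => i /le_b ib.
by rewrite /= inordK.
Qed.

Lemma qpochS a : qpoch a.+1 = qpoch a * (1 - 'X^(a.+1)).
Proof. by rewrite /qpoch big_nat_recr. Qed.

Lemma qbinomE a b : (b <= a)%N ->
  qbinom a b * (qpoch b * qpoch (a - b)) = qpoch a.
Proof.
move=> leba; rewrite /qbinom ltnNge leba /=; apply: divpK.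
have [g ->] : exists g, qpoch a = g * (qpoch b * qpoch (a - b)).
  elim: a b leba => [|a IHa] [|b] leba.
  - by exists 1; rewrite /qpoch big_nil !mul1r.
  - by [].
  - by exists 1; rewrite /qpoch big_nil !mul1r.
  have [g gE] := IHa b leba; rewrite subSS.
  have [leab|ltba] := leqP a b.
    have -> : b = a by lia.
    by exists 1; rewrite subnn [qpoch 0]/qpoch big_nil mulr1 mul1r.
  have [h hE] := IHa b.+1 ltba.
  exists (g + 'X^(b.+1) * h); rewrite qpochS.
  have abE : (a - b = (a - b.+1).+1)%N by lia.
  have -> : (1 - 'X^(a.+1) : {poly rat})
      = (1 - 'X^(b.+1)) + 'X^(b.+1) * (1 - 'X^(a - b)).
    by rewrite mulrBr mulr1 -exprD addrA subrK; congr (1 - 'X^_); lia.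
  by rewrite mulrDr {1}gE hE abE !qpochS; ring.
by rewrite dvdp_mull.
Qed.

(* Main.v *)
Require Import Defs.
From HB Require Import structures.
From mathcomp Require Import all_boot all_order all_algebra all_fingroup.
From mathcomp Require Import finmap.
From mathcomp Require Import all_classical reals trigo.
From mathcomp Require Import complex.
From mathcomp Require Import zify ring lra.

Set Implicit Arguments.
Unset Strict Implicit.
Unset Printing Implicit Defensive.

Import Order.TTheory GRing.Theory Num.Theory.

Local Open Scope classical_set_scope.
Local Open Scope ring_scope.

(** Each of the four quantities counts, up to the factor [k ^ (n - 1)], the
    partitions with at most [k - cd w] parts, all smaller than [n], whose total
    is congruent to [- maj w] modulo [n].

    For the coefficient of [w] itself, let [D i] be the number of descents of
    [w] at positions [i, ..., n - 1].  Subtracting [D i] and a constant from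
    [v i] makes the inequalities on [v] say exactly that the result is a
    partition with at most [n - 1] parts of size at most [k - cd w].  As the
    [D i] add up to [maj w], the constant is determined by the sum of [v] being
    zero, and it is an integer exactly when [n] divides the total plus [maj w].
    This is [card_cellini_vectors].

    All else is about the Gaussian polynomial [gauss q a b], the sum of [q] to
    the total over the partitions in the [a x b] box.
    Splitting off the largest part gives a Pascal recurrence, hence the product
    formula [gauss_qpoch].  Its symmetry in [a] and [b] exchanges the bounds on
    the number and the size of the parts, without conjugating partitions; and
    it identifies [qbinom] with [gauss], so that the sum of every [n]-th
    coefficient is the required count.

    For the Ramanujan sums, the congruence is detected by averaging over the
    [n]-th roots of unity [z ^ j], grouped by their order [d] ([sum_fractions]).
    The same recurrence says that the Gaussian polynomials [gauss q m b] are the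
    coefficients of the series inverse to the product of the [1 - q ^ i t] for
    [i <= b].  When [q] has order [d] and [b + 1 = d e] this product is
    [(1 - t ^ d) ^ e], which is also what [q = 1] and [b + 1 = e] give after
    replacing [t] by [t ^ d]; so the value is a binomial coefficient if [d]
    divides [m] and zero otherwise ([gauss_prim_root]). *)

(** * Partitions in a box *)

(** An explicit list, so that sums and counts over the partitions in the box
    follow the recursion on their largest part. *)
Fixpoint box (a : nat) : nat -> seq (seq nat) :=
  if a is a'.+1 then
    fix box_a b :=
      if b is b'.+1 then [seq b :: s | s <- box a' b] ++ box_a b' else [:: [::]]
  else fun=> [:: [::]].

Lemma boxn0 a : box a 0 = [:: [::]].
Proof. by case: a. Qed.

Lemma boxSS a b :
  box a.+1 b.+1 = [seq b.+1 :: s | s <- box a b.+1] ++ box a.+1 b.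
Proof. by []. Qed.

Lemma mem_box a b s :
  (s \in box a b) = [&& sorted geq s, all (ltn 0) s, (size s <= a)%N
                      & all (fun x => x <= b)%N s].
Proof.
have geq_trans : transitive geq by move=> y x z /= xy yz; apply: leq_trans xy.
have nilP0 (t : seq nat) : t <> [::] -> (t \in [:: [::] : seq nat]) = false.
  by move=> t0; rewrite inE; apply/eqP.
elim: a b s => [|a IHa] b s.
  by case: s => [|x s] //; rewrite nilP0 //= !andbF.
elim: b s => [|b IHb] s.
  case: s => [|x s] //; rewrite boxn0 nilP0//; apply/esym/negP.
  by case/and4P=> _ /andP[x0 _] _ /andP[]; move: x0 => /=; lia.
rewrite boxSS mem_cat IHb.
have bb1 t : all (fun x => x <= b)%N t -> all (fun x => x <= b.+1)%N t.
  by apply: sub_all => i /leqW.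
apply/idP/idP.
  case/orP => [/mapP[t]|/and4P[-> -> -> /bb1 ->//]].
  rewrite IHa => /and4P[st t0 ts tb] -> /=.
  by rewrite path_sortedE// st t0 tb leqnn ltnS ts !andbT.
case/and4P; case: s => [|x s]; first by rewrite orbT.
rewrite /= path_sortedE// => /andP[xs ss] /andP[x0 s0] sa /andP[xb sb].
have [xE|xb'] := eqVneq x b.+1.
  apply/orP; left; rewrite xE; apply: map_f.
  by rewrite IHa ss s0 sb -ltnS sa.
apply/orP; right; rewrite xs ss x0 s0 sa /=.
have xb1 : (x <= b)%N by lia.
by rewrite xb1 /=; apply: sub_all xs => i /= ix; lia.
Qed.

Lemma box_uniq a b : uniq (box a b).
Proof.
elim: a b => [|a IHa] b //; elim: b => [|b IHb] //.
rewrite boxSS cat_uniq IHb map_inj_uniq ?IHa; last by move=> s t [].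
rewrite andTb andbT; apply/hasPn => s; rewrite mem_box => /and4P[_ _ _ sb].
apply/negP => /mapP[t _ sE]; move: sb; rewrite sE /= ltnn//.
Qed.

(** The bridge from cardinals of finite classical sets, in which the counts are
    phrased, to explicit lists. *)
Lemma card_fset_set_seq (T : choiceType) (A : set T) (s : seq T) :
  uniq s -> (forall x, A x <-> x \in s) -> #|` fset_set A| = size s.
Proof.
move=> us As; have -> : A = [set` [fset x in s]%fset].
  by apply/seteqP; split=> x /=; rewrite inE => /As.
by rewrite set_fsetK card_fseq undup_id.
Qed.

Lemma eqz_mod_oppN (x m n : nat) :
  ((x%:Z = - m%:Z %[mod n%:Z])%Z) <-> (n %| x + m)%N.
Proof.
transitivity ((x%:Z == - m%:Z %[mod n%:Z])%Z); first by split => [->|/eqP].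
by rewrite eqz_mod_dvd opprK -PoszD dvdzE.
Qed.

Lemma count_partitionsE a b n m :
  count_partitions a b n (- m%:Z) = count (fun s => n %| sumn s + m)%N (box a b).
Proof.
rewrite -size_filter; apply: card_fset_set_seq; first exact/filter_uniq/box_uniq.
move=> s; rewrite mem_filter mem_box; split.
  by case=> [[-> -> -> ->]] /eqz_mod_oppN ->.
by case/andP => ? /and4P[*]; split=> //; apply/eqz_mod_oppN.
Qed.

(** * Gaussian polynomials *)

(** The Gaussian binomial coefficient [a + b] over [a] at an arbitrary element
    [q] of a commutative ring: it is needed for the indeterminate, for roots of
    unity and for [q = 1]. *)
Definition gauss (A : comNzRingType) (q : A) (a b : nat) : A :=
  \sum_(s <- box a b) q ^+ sumn s.

Section Gauss.
Variables (A : comNzRingType) (q : A).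

Lemma gaussn0 a : gauss q a 0 = 1.
Proof. by rewrite /gauss boxn0 big_seq1. Qed.

Lemma gauss0n b : gauss q 0 b = 1.
Proof. by rewrite /gauss big_seq1. Qed.

Lemma gaussSS a b :
  gauss q a.+1 b.+1 = q ^+ b.+1 * gauss q a b.+1 + gauss q a.+1 b.
Proof.
rewrite /gauss boxSS big_cat big_map mulr_sumr; congr (_ + _).
by apply: eq_bigr => s _; rewrite exprD.
Qed.

End Gauss.

Lemma gauss1 (A : comNzRingType) a b : gauss (1 : A) a b = 'C(a + b, a)%:R.
Proof.
elim: a b => [|a IHa] b; first by rewrite gauss0n bin0.
elim: b => [|b IHb]; first by rewrite gaussn0 addn0 binn.
by rewrite gaussSS IHa IHb expr1n mul1r -natrD addnS addSn binS addnC addnS.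
Qed.

Lemma qpoch_neq0 a : qpoch a != 0.
Proof.
rewrite /qpoch prodf_seq_neq0; apply/allP => i; rewrite mem_index_iota => /andP[i0 _].
apply/eqP => /(congr1 (fun p : {poly rat} => p`_0)) /eqP.
by rewrite coefB coef1 coefXn coef0 (ltn_eqF i0) subr0 oner_eq0.
Qed.

(** Induction along the recurrence, because
    [1 - X^(a + b + 2) = X^(b + 1) (1 - X^(a + 1)) + (1 - X^(b + 1))]. *)
Lemma gauss_qpoch a b :
  gauss ('X : {poly rat}) a b * (qpoch a * qpoch b) = qpoch (a + b).
Proof.
have q0 : qpoch 0 = 1 by rewrite /qpoch big_nil.
elim: a b => [|a IHa] b; first by rewrite gauss0n q0 !mul1r.
elim: b => [|b IHb]; first by rewrite gaussn0 q0 mulr1 mul1r addn0.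
rewrite gaussSS addnS [RHS]qpochS.
transitivity ('X^(b.+1) * (gauss 'X a b.+1 * (qpoch a * qpoch b.+1))
                * (1 - 'X^(a.+1))
              + gauss 'X a.+1 b * (qpoch a.+1 * qpoch b) * (1 - 'X^(b.+1))).
  by rewrite !qpochS; ring.
by rewrite IHa IHb addnS -addSn -addnS [in RHS]exprD; ring.
Qed.

Lemma gauss_sym a b : gauss ('X : {poly rat}) a b = gauss 'X b a.
Proof.
apply: (mulIf (mulf_neq0 (qpoch_neq0 a) (qpoch_neq0 b))).
by rewrite gauss_qpoch [qpoch a * _]mulrC gauss_qpoch addnC.
Qed.

Lemma qbinom_gauss m b : qbinom (m + b) b = gauss 'X m b.
Proof.
apply: (mulIf (mulf_neq0 (qpoch_neq0 m) (qpoch_neq0 b))).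
by rewrite gauss_qpoch -[in RHS](@qbinomE (m + b) b) ?leq_addl// addnK [qpoch m * _]mulrC.
Qed.

(** Each partition contributes a single monomial, which is met by the sum over
    [r] exactly when its exponent is a multiple of [n]. *)
Lemma sum_coef_multiples n a b j : (0 < n)%N ->
  \sum_(r \in [set: nat]) ('X^j * gauss ('X : {poly rat}) a b)`_(r * n)
    = (count (fun s => n %| sumn s + j)%N (box a b))%:R.
Proof.
(* [N] exceeds all exponents, so the terms with [r >= N] vanish. *)
move=> n0; pose N := (\max_(s <- box a b) (sumn s + j)).+1.
have coefE i : ('X^j * gauss ('X : {poly rat}) a b)`_i
    = \sum_(s <- box a b) (i == sumn s + j)%N%:R.
  rewrite mulr_sumr coef_sum; apply: eq_bigr => s _.
  by rewrite -exprD coefXn addnC.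
have ltN s : s \in box a b -> (sumn s + j < N)%N.
  by move=> sb; rewrite ltnS; exact: (@leq_bigmax_seq _ _ xpredT (fun s => sumn s + j)%N).
rewrite -(@fsbig_widen _ _ _ _ `I_N)//; last first.
  move=> r [_ /= /negP]; rewrite -leqNgt => Nr; rewrite coefE big_seq big1// => s /ltN sN.
  by rewrite gtn_eqF//; apply: leq_trans (leq_pmulr _ n0); apply: leq_trans Nr.
rewrite -(fsbig_ord _ _ (fun r => ('X^j * gauss ('X : {poly rat}) a b)`_(r * n))).
under eq_bigr do rewrite coefE.
rewrite exchange_big /= -sum1_count natr_sum [RHS]big_mkcond /=.
rewrite big_seq [RHS]big_seq; apply: eq_bigr => s /ltN sN.
case: ifP => [/dvdnP[c cE]|ndvd]; last first.
  rewrite big1// => r _; case: eqP => // rE.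
  by move: ndvd; rewrite -rE dvdn_mull.
have cN : (c < N)%N by apply: leq_ltn_trans sN; rewrite cE leq_pmulr.
rewrite (bigD1 (Ordinal cN))//= cE eqxx big1 ?addr0// => r /eqP rc.
by case: eqP => // /eqP; rewrite eqn_pmul2r// => /eqP rE; case: rc; apply: val_inj.
Qed.

Lemma count_box_sym n a b j : (0 < n)%N ->
  count (fun s => n %| sumn s + j)%N (box a b)
    = count (fun s => n %| sumn s + j)%N (box b a).
Proof.
move=> n0; apply/eqP; rewrite -(eqr_nat rat) -!sum_coef_multiples// gauss_sym//.
Qed.

(** * The generating function, and roots of unity *)

(** One step of the generating function: the recurrence for [u] says that
    multiplying its series by [1 - c t] gives the series of [v]; the last term
    is the overflow caused by truncation. *)
Lemma mul_linear_poly (A : comNzRingType) (c : A) (u v : nat -> A) M :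
  u 0%N = v 0%N -> (forall m, u m.+1 = c * u m + v m.+1) ->
  (1 - c *: 'X) * \poly_(m < M.+1) u m
    = \poly_(m < M.+1) v m - (c * u M) *: 'X^(M.+1).
Proof.
move=> u0 uS; apply/polyP => i.
rewrite mulrBl mul1r -scalerAl !coefB !coefZ coefXM !coef_poly coefXn.
case: i => [|i] /=; first by rewrite !mulr0 u0.
rewrite !ltnS eqSS; have [iM|Mi|->] := ltngtP i M.
- by rewrite uS mulr0 subr0 [_ + v _]addrC addrK.
- by rewrite !mulr0.
- by rewrite mulr1.
Qed.

(** Series are truncated to polynomials, and equality of series becomes equality
    modulo a power of ['X].  The Pascal recurrence shows that the factor
    [1 - q ^ b t] turns the series for [b] into the one for [b - 1]. *)
Lemma gauss_series (A : comNzRingType) (q : A) b M :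
  exists r : {poly A},
    \prod_(i < b.+1) (1 - q ^+ i *: 'X) * \poly_(m < M.+1) gauss q m b
      = 1 + r * 'X^(M.+1).
Proof.
elim: b => [|b [r IHb]].
  exists (- 1); rewrite big_ord1 expr0.
  rewrite (mul_linear_poly (v := fun m => (m == 0)%N%:R)); last 2 first.
  - by rewrite gaussn0.
  - by move=> m; rewrite !gaussn0 mul1r addr0.
  rewrite gaussn0 mulr1 scale1r mulN1r; congr (_ - _).
  apply/polyP => i; rewrite coef_poly coef1.
  by case: i => [|i] //=; case: ifP.
exists (r - (\prod_(i < b.+1) (1 - q ^+ i *: 'X)) * (q ^+ b.+1 * gauss q M b.+1)%:P).
rewrite big_ord_recr /= -mulrA.
rewrite (mul_linear_poly (v := fun m => gauss q m b)); last 2 first.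
- by rewrite !gauss0n.
- by move=> m; rewrite gaussSS.
by rewrite mulrBr IHb -mul_polyC; ring.
Qed.

(** Inverses of [p] modulo powers of ['X] agree where both are determined, since
    [f - g = g (p f - 1) - f (p g - 1)]. *)
Lemma inverse_series_uniq (A : comNzRingType) (p f g r s : {poly A}) M N i :
  p * f = 1 + r * 'X^M -> p * g = 1 + s * 'X^N -> (i < M)%N -> (i < N)%N ->
  f`_i = g`_i.
Proof.
move=> pf pg iM iN.
have fg : f - g = g * r * 'X^M - f * s * 'X^N.
  transitivity (g * (p * f - 1) - f * (p * g - 1)); first by ring.
  by rewrite pf pg; ring.
by apply/eqP; rewrite -subr_eq0 -coefB fg coefB !coefMXn iM iN subr0.
Qed.

(** The reciprocal form of the factorization of ['X^d - 1]; the linear factors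
    are normalized by their constant terms instead of leading coefficients. *)
Lemma prod_prim_root (F : fieldType) d (z : F) : d.-primitive_root z ->
  \prod_(i < d) (1 - z ^+ i *: 'X) = 1 - 'X^d.
Proof.
move=> zd; have d0 := prim_order_gt0 zd.
have z0 : z != 0.
  apply/eqP => z0; have /eqP := prim_expr_order zd.
  by rewrite z0 expr0n gtn_eqF// eq_sym oner_eq0.
have zVd : d.-primitive_root z^-1.
  have -> : z^-1 = z ^+ d.-1.
    by apply: (mulfI z0); rewrite divff// -exprS prednK// prim_expr_order.
  by rewrite prim_root_exp_coprime// coprimePn.
have fac := factor_Xn_sub_1 zVd; rewrite big_mkord in fac.
have -> : \prod_(i < d) (1 - z ^+ i *: 'X) = (\prod_(i < d) - z ^+ i) *: ('X^d - 1).
  rewrite -fac -scaler_prod; apply: eq_bigr => i _.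
  rewrite scalerBr scaleNr -mul_polyC scaleNr opprK -mul_polyC -polyCM exprVn.
  by rewrite divff ?expf_neq0// addrC.
have /(congr1 (fun p : {poly F} => p.[0])) := fac.
rewrite horner_prod !hornerE expr0n gtn_eqF// sub0r => facN.
have -> : \prod_(i < d) - z ^+ i = -1.
  transitivity (\prod_(i < d) ('X - (z^-1 ^+ i)%:P).[0])^-1; last first.
    by rewrite facN invrN invr1.
  rewrite -prodfV; apply: eq_bigr => i _.
  by rewrite !hornerE invrN exprVn invrK.
by rewrite scaleN1r opprB.
Qed.

Lemma prod_prim_root_mul (F : fieldType) d e (z : F) : d.-primitive_root z ->
  \prod_(i < d * e) (1 - z ^+ i *: 'X) = (1 - 'X^d) ^+ e.
Proof.
move=> zd; elim: e => [|e IHe]; first by rewrite muln0 big_ord0.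
rewrite mulnS big_split_ord /= prod_prim_root// exprS -IHe; congr (_ * _).
by apply: eq_bigr => i _; rewrite exprD prim_expr_order// mul1r.
Qed.

(** Both sides are coefficients of the series inverse to [(1 - t ^ d) ^ e]: the
    left one by [gauss_series] at [z], the right one by [gauss_series] at [1]
    with [t ^ d] substituted for [t]. *)
Lemma gauss_prim_root (F : fieldType) d e m (z : F) :
  d.-primitive_root z -> (0 < e)%N ->
  gauss z m (d * e).-1
    = if (d %| m)%N then 'C(m %/ d + e.-1, m %/ d)%:R else 0.
Proof.
move=> zd e0; have d0 := prim_order_gt0 zd.
have [r zE] := gauss_series z (d * e).-1 m.
have [s oneE] := gauss_series (1 : F) e.-1 m.
rewrite prednK ?muln_gt0 ?d0// prod_prim_root_mul// in zE.
have {}oneE : (1 - 'X) ^+ e * \poly_(i < m.+1) gauss (1 : F) i e.-1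
    = 1 + s * 'X^(m.+1).
  rewrite -oneE prednK//; congr (_ * _).
  under eq_bigr do rewrite expr1n scale1r.
  by rewrite prodr_const card_ord.
have {oneE} := congr1 (fun p => p \Po 'X^d) oneE.
rewrite comp_polyM rmorphXn /= comp_polyB comp_polyD comp_polyM comp_polyC.
rewrite comp_polyX comp_Xn_poly -exprM => oneE.
have := inverse_series_uniq zE oneE (ltnSn m) (leq_pmull _ d0).
rewrite coef_comp_poly_Xn// !coef_poly ltnSn => ->.
by rewrite ltnS leq_div gauss1.
Qed.

Lemma sum_prim_root (F : fieldType) n (z : F) a : n.-primitive_root z ->
  \sum_(1 <= j < n.+1) z ^+ (j * a) = if (n %| a)%N then n%:R else 0.
Proof.
move=> zn.
have -> : \sum_(1 <= j < n.+1) z ^+ (j * a) = z ^+ a * \sum_(j < n) (z ^+ a) ^+ j.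
  rewrite big_add1 /= big_mkord mulr_sumr; apply: eq_bigr => j _.
  by rewrite mulnC exprM exprS.
rewrite (prim_order_dvd zn); case: eqP => [->|/eqP za].
  by under eq_bigr do rewrite expr1n; rewrite mul1r sumr_const card_ord.
have /eqP := subrX1 (z ^+ a) n.
rewrite -exprM mulnC exprM (prim_expr_order zn) expr1n subrr eq_sym mulf_eq0.
by rewrite subr_eq0 (negbTE za) => /eqP ->; rewrite mulr0.
Qed.

(** Writing [j / n] in lowest terms [l / d] maps [1, ..., n] bijectively onto
    the pairs of a divisor [d] of [n] and some [1 <= l <= d] coprime to [d]. *)
Lemma sum_fractions (V : nmodType) n (F : nat -> V) : (0 < n)%N ->
  \sum_(1 <= j < n.+1) F j
    = \sum_(d <- divisors n) \sum_(1 <= l < d.+1 | coprime l d) F (l * (n %/ d))%N.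
Proof.
move=> n0.
transitivity (\sum_(d <- divisors n)
                \sum_(1 <= j < n.+1 | (n %/ gcdn j n == d)%N) F j).
  under [RHS]eq_bigr do rewrite big_mkcond.
  rewrite exchange_big /=; apply: eq_bigr => j _.
  have dj : (n %/ gcdn j n)%N \in divisors n.
    by rewrite -dvdn_divisors// dvdn_div// dvdn_gcdr.
  rewrite (bigD1_seq (n %/ gcdn j n)%N) ?divisors_uniq//= eqxx.
  by rewrite big1 ?addr0// => d; rewrite eq_sym => /negbTE ->.
rewrite big_seq [RHS]big_seq; apply: eq_bigr => d.
rewrite -dvdn_divisors// => /dvdnP[e nE].
have [e0 d0] : (0 < e)%N /\ (0 < d)%N.
  by apply/andP; rewrite -muln_gt0 -nE.
have ndE : (n %/ d = e)%N by rewrite nE mulnK.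
rewrite ndE -[LHS]big_filter -[RHS]big_filter.
rewrite -(big_map (fun l => l * e)%N xpredT F); apply: perm_big.
have inj : injective (fun l => l * e)%N.
  by move=> x y /eqP; rewrite eqn_pmul2r// => /eqP.
apply: uniq_perm; rewrite ?map_inj_uniq ?filter_uniq ?iota_uniq// => j.
rewrite mem_filter mem_index_iota; apply/idP/mapP.
  case/andP => /eqP gE /andP[j0 jn].
  have gcdE : gcdn j n = e.
    apply/eqP; rewrite -(eqn_pmul2l d0) -{1}gE divnK ?dvdn_gcdr//.
    by rewrite nE mulnC.
  have /dvdnP[l jE] : (e %| j)%N by rewrite -gcdE dvdn_gcdl.
  exists l => //; rewrite mem_filter mem_index_iota; apply/and3P; split.
  - by move: gcdE; rewrite jE nE [(e * d)%N]mulnC -muln_gcdl /coprime; nia.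
  - by move: j0; rewrite jE muln_gt0 => /andP[].
  - by move: jn; rewrite jE nE !ltnS mulnC leq_pmul2l.
case=> l; rewrite mem_filter mem_index_iota => /and3P[/eqP cop l0 ld] ->.
rewrite {1 2}nE [(e * d)%N]mulnC -muln_gcdl cop mul1n mulnK// eqxx.
by rewrite muln_gt0 l0 e0 nE mulnC !ltnS leq_pmul2l.
Qed.

(** Roots of unity filter: [z ^ (j * a)], summed over [j], detects whether [n]
    divides [a].  Exchanging the sums makes [gauss] appear at every power of
    [z], and its value there depends on the order of that power only. *)
Lemma count_box_filter (F : fieldType) n m c (z : F) : n.-primitive_root z ->
  n%:R * (count (fun s => n %| sumn s + c)%N (box m n.-1))%:R
    = \sum_(d <- divisors n | (d %| m)%N)
        'C((n + m - d) %/ d, m %/ d)%:R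
        * \sum_(1 <= l < d.+1 | coprime l d) z ^+ (l * (n %/ d) * c).
Proof.
move=> zn; have n0 := prim_order_gt0 zn.
transitivity (\sum_(s <- box m n.-1) \sum_(1 <= j < n.+1) z ^+ (j * (sumn s + c))).
  rewrite -sum1_count natr_sum mulr_sumr big_mkcond; apply: eq_bigr => s _.
  by rewrite sum_prim_root//; case: ifP; rewrite ?mulr1.
rewrite exchange_big /=.
transitivity (\sum_(1 <= j < n.+1) z ^+ (j * c) * gauss (z ^+ j) m n.-1).
  apply: eq_bigr => j _; rewrite mulr_sumr; apply: eq_bigr => s _.
  by rewrite mulnDr addnC exprD [z ^+ (j * sumn s)]exprM.
rewrite sum_fractions// [RHS]big_mkcond big_seq [RHS]big_seq; apply: eq_bigr => d.
rewrite -dvdn_divisors// => dn; have /dvdnP[e nE] := dn.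
have [e0 d0] : (0 < e)%N /\ (0 < d)%N.
  by apply/andP; rewrite -muln_gt0 -nE.
have ndE : (n %/ d = e)%N by rewrite nE mulnK.
have gaussE l : coprime l d -> gauss (z ^+ (l * e)) m n.-1
    = if (d %| m)%N then 'C((n + m - d) %/ d, m %/ d)%:R else 0.
  move=> ld; have zd : d.-primitive_root (z ^+ (l * e)).
    by rewrite mulnC exprM -ndE prim_root_exp_coprime ?dvdn_prim_root.
  have -> : n.-1 = (d * e).-1 by rewrite nE mulnC.
  rewrite gauss_prim_root//; case: ifP => // /dvdnP[f mE].
  rewrite mE mulnK// nE -mulnDl -{2}[d]mul1n -mulnBl mulnK//.
  by congr ('C(_, _)%:R); lia.
rewrite ndE; case: ifP => dm; last first.
  by rewrite big1// => l ld; rewrite gaussE// dm mulr0.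
by rewrite mulr_sumr; apply: eq_bigr => l ld; rewrite gaussE// dm mulrC.
Qed.

Section Expi.
Variable R : realType.

Lemma expiD (s t : R) : expi (s + t) = expi s * expi t.
Proof. by rewrite /expi cosD sinD; simpc; congr (_ +i* _)%C; rewrite addrC. Qed.

Lemma expi_natmul (t : R) j : expi (t *+ j) = expi t ^+ j.
Proof.
elim: j => [|j IHj]; first by rewrite mulr0n /expi cos0 sin0.
by rewrite mulrS expiD IHj exprS.
Qed.

(** If the order were [m < n], then [cos (2 x) = 1] for [x = pi m / n], whence
    [sin x = 0], although [x] lies strictly between [0] and [pi]. *)
Lemma expi_prim n : (0 < n)%N ->
  n.-primitive_root (expi (- (pi *+ 2 / n%:R) : R)).
Proof.
move=> n0; have nR : (n%:R : R) != 0 by rewrite pnatr_eq0 -lt0n.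
have zn : expi (- (pi *+ 2 / n%:R) : R) ^+ n = 1.
  by rewrite -expi_natmul mulNrn -[_ *+ n]mulr_natr divfK// /expi cosN sinN cos2pi sin2pi oppr0.
have [m zm mn] := prim_order_exists n0 zn.
have [mE|mn_neq] := eqVneq m n; first by rewrite -{1}mE.
have m0 := prim_order_gt0 zm.
have mltn : (m < n)%N by rewrite ltn_neqAle mn_neq dvdn_leq.
pose x : R := pi * (m%:R / n%:R).
have xpi : 0 < x < pi.
  have mR : (0 : R) < m%:R by rewrite ltr0n.
  have nR0 : (0 : R) < n%:R by rewrite ltr0n.
  rewrite /x mulr_gt0 ?pi_gt0 ?divr_gt0//=.
  by rewrite -[ltRHS]mulr1 ltr_pM2l ?pi_gt0// ltr_pdivrMr// mul1r ltr_nat.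
have := prim_expr_order zm; rewrite -expi_natmul mulNrn.
have -> : pi *+ 2 / n%:R *+ m = x *+ 2 
  by rewrite mulrnAl mulrnAC -mulrnAr -[_^-1 *+ m]mulr_natl.
case; rewrite cosN cos_mulr2n => cosx _.
have cos1 : cos x ^+ 2 = 1 by lra.
have := cos2Dsin2 x; rewrite cos1 => sin1.
have /eqP : sin x ^+ 2 = 0 by lra.
by rewrite sqrf_eq0 gt_eqF// sin_gt0_pi.
Qed.

End Expi.

(** * Cellini vectors *)

(** The zeros of a weakly decreasing sequence come last, so removing them is
    invisible to [nth] with default value zero.  This passes from sequences of
    fixed length, as given by vectors, to partitions with positive parts. *)
Lemma sorted_nth_filter_pos (t : seq nat) i :
  sorted geq t -> nth 0%N [seq x <- t | (0 < x)%N] i = nth 0%N t i.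
Proof.
have geq_trans : transitive geq by move=> y x z /= xy yz; apply: leq_trans xy.
elim: t i => [|x t IHt] i //=; rewrite path_sortedE// => /andP[xt st].
have [x0|x0] := posnP x; last by case: i => [|i] //=; apply: IHt.
have t0 : all (pred1 0%N) t.
  by apply: sub_all xt => y /=; rewrite x0 leqn0.
have /eqP -> : [seq x <- t | (0 < x)%N] == [::].
  rewrite -size_eq0 size_filter -leqn0 leqNgt -has_count; apply/hasPn => y yt.
  by have /eqP -> := allP t0 y yt.
rewrite nth_nil x0; case: i => [|i] //=.
have [it|ti] := ltnP i (size t); last by rewrite nth_default.
by rewrite (eqP (all_nthP 0%N t0 i it)).
Qed.

Lemma eq_from_nth0 (s t : seq nat) :
  all (ltn 0) s -> all (ltn 0) t -> nth 0%N s =1 nth 0%N t -> s = t.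
Proof.
have size_le (u v : seq nat) :
    all (ltn 0) v -> nth 0%N u =1 nth 0%N v -> (size v <= size u)%N.
  move=> v0 uv; rewrite leqNgt; apply/negP => lt_uv.
  by have := all_nthP 0%N v0 _ lt_uv; rewrite -uv nth_default.
move=> s0 t0 st; apply: (@eq_from_nth _ 0%N) => [|i _]; last exact: st.
by apply/eqP; rewrite eqn_leq !size_le// => i; rewrite st.
Qed.

Section Vectors.
Variables (p k : nat) (w : 'S_p.+1).

(** Valued in [nat] and indexed by [nat], so that weak and strict inequalities
    of Cellini vectors merge into one and sums range over intervals. *)
Definition desc (i : nat) : nat := cyc_desc w (inord i).
Definition descs_from (i : nat) : nat := \sum_(i <= j < p) desc j.

Lemma cdE : cd w = (descs_from 0 + desc p)%N.
Proof.
rewrite /cd /descs_from -sum1_card big_mkcond -(big_nat_recr p)//= big_mkord.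
by apply: eq_bigr => i _; rewrite inE /desc inord_val; case: cyc_desc.
Qed.

(** A descent at the index [j] is counted by [descs_from i] for [i <= j], that
    is [j + 1] times. *)
Lemma majE : maj w = (\sum_(i < p.+1) descs_from i)%N.
Proof.
transitivity (\sum_(0 <= j < p) \sum_(0 <= i < p.+1 | (i <= j)%N) desc j)%N.
  rewrite /maj big_mkcond big_ord_recr /= ltnn addn0 big_mkord.
  apply: eq_bigr => j _; rewrite /= !ltnS ltn_ord /=.
  have -> : widen_ord (leqnSn p) j = inord j.
    by apply: val_inj; rewrite /= inordK// ltnS ltnW.
  transitivity (\sum_(0 <= i < j.+1) desc (nat_of_ord j))%N.
    by rewrite sum_nat_const_nat subn0 /desc; case: cyc_desc; rewrite ?muln1 ?muln0.
  by rewrite (big_nat_widen 0 j.+1 p.+1)//; have := ltn_ord j; lia.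
rewrite (exchange_big_dep xpredT)//= -(big_mkord xpredT descs_from).
apply: eq_bigr => i _.
by rewrite /descs_from [RHS](big_nat_widenl _ 0)//; apply: eq_bigl.
Qed.

Lemma cellini_vectorsP (v : {ffun 'I_p.+1 -> int}) :
  cellini_vectors k w v <->
  [/\ \sum_i v i = 0,
      forall i, (i < p)%N -> v (inord i.+1) + (desc i)%:Z <= v (inord i)
    & v ord0 + (desc p)%:Z <= v ord_max + k%:Z].
Proof.
have ordSi i : (i < p)%N -> ordS (inord i : 'I_p.+1) = inord i.+1.
  by move=> ip; apply: val_inj; rewrite /= !inordK ?modn_small// ltnW.
have ordSp : ordS (ord_max : 'I_p.+1) = ord0.
  by apply: val_inj; rewrite /= modnn.
have inordp : inord p = ord_max :> 'I_p.+1.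
  by apply: val_inj; rewrite /= inordK.
have lastE (i : 'I_p.+1) : i.+1 = p.+1 -> i = ord_max.
  by case=> ip; apply: val_inj.
split.
- case=> sum0 [dec wid decs wids]; split=> // [i ip|].
    have i1 : ((inord i : 'I_p.+1).+1 < p.+1)%N by rewrite inordK ?ltnS// ltnW.
    have := dec _ i1; have := decs _ i1; rewrite /desc ordSi//.
    by case: cyc_desc => [/(_ isT)|_]; lia.
  have := wid ord_max erefl; have := wids ord_max erefl; rewrite /desc inordp ordSp.
  by case: cyc_desc => [/(_ isT)|_]; lia.
- case=> sum0 dec wid; split=> //.
  have dec' (i : 'I_p.+1) : (i.+1 < p.+1)%N ->
      v (ordS i) + (cyc_desc w i)%:Z <= v i.
    by move=> ip; have := dec i ip; rewrite -ordSi// /desc inord_val.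
  have wid' (i : 'I_p.+1) : i.+1 = p.+1 ->
      v (ordS i) + (cyc_desc w i)%:Z <= v i + k%:Z.
    by move=> /lastE ->; rewrite ordSp; move: wid; rewrite /desc inordp.
  split=> i hi; [have := dec' i hi|have := wid' i hi|have := dec' i hi|have := wid' i hi];
    by case: cyc_desc => //; lia.
Qed.

(** The quotient is exact in the cases of interest; it is the constant that
    makes the entries sum to zero.  The partition is padded with zeros, and its
    last entry is always such a zero. *)
Definition vector_of_partition (s : seq nat) : {ffun 'I_p.+1 -> int} :=
  [ffun i : 'I_p.+1 => (nth 0%N s i + descs_from i)%:Z
                        - ((sumn s + maj w) %/ p.+1)%:Z].

Lemma descs_fromS i : (i < p)%N -> descs_from i = (desc i + descs_from i.+1)%N.
Proof. by move=> ip; rewrite /descs_from big_ltn. Qed.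

Lemma descs_from_last : descs_from p = 0%N.
Proof. by rewrite /descs_from big_geq. Qed.

Lemma cd_le_of_vector v : cellini_vectors k w v -> (cd w <= k)%N.
Proof.
case/cellini_vectorsP => _ dec wid.
have low j : (j <= p)%N -> v ord_max + (descs_from (p - j))%:Z <= v (inord (p - j)).
  elim: j => [|j IHj] jp.
    rewrite subn0 descs_from_last addr0 (_ : inord p = ord_max)//.
    by apply: val_inj; rewrite /= inordK.
  have pj : (p - j.+1 < p)%N by lia.
  have := dec _ pj; rewrite descs_fromS// (_ : (p - j.+1).+1 = (p - j)%N); last by lia.
  by have := IHj (ltnW jp); lia.
have := low p (leqnn p); rewrite subnn (_ : inord 0 = ord0); last first.
  by apply: val_inj; rewrite /= inordK.
by rewrite cdE; lia.
Qed.

(** The last entries agree, and there both partitions contribute zero, so the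
    subtracted constants agree. *)
Lemma vector_of_partition_inj :
  {in [pred s | all (ltn 0) s & (size s <= p)%N] &, injective vector_of_partition}.
Proof.
move=> s t /andP[s0 sp] /andP[t0 tp] /ffunP st.
have st' i : (i <= p)%N ->
    (nth 0%N s i)%:Z - ((sumn s + maj w) %/ p.+1)%:Z
      = (nth 0%N t i)%:Z - ((sumn t + maj w) %/ p.+1)%:Z.
  by move=> ip; have := st (inord i); rewrite !ffunE inordK//; lia.
have := st' p (leqnn p); rewrite !(nth_default _ sp) !(nth_default _ tp) => stp.
apply: eq_from_nth0 => // i; have [ip|pi] := leqP i p.
  by have := st' i ip; lia.
by rewrite !nth_default//; [apply: leq_trans tp _|apply: leq_trans sp _]; apply: ltnW.
Qed.

Lemma sum_nth0 (s : seq nat) N : (size s <= N)%N ->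
  (\sum_(i < N) nth 0%N s i)%N = sumn s.
Proof.
move=> sN; rewrite sumnE (big_nth 0%N) -(big_mkord xpredT (nth 0%N s)).
rewrite (@big_cat_nat _ _ _ (size s))//= [X in (_ + X)%N = _]big_nat_cond [X in (_ + X)%N = _]big1 ?addn0//.
by move=> i /andP[/andP[si _] _]; rewrite nth_default.
Qed.

Lemma vector_of_partition_sum s : (size s <= p)%N ->
  (\sum_i vector_of_partition s i == 0) = (p.+1 %| sumn s + maj w)%N.
Proof.
move=> sp; under eq_bigr do rewrite ffunE.
rewrite sumrB sumr_const card_ord -(big_morph Posz PoszD (erefl _)) big_split /=.
rewrite sum_nth0 ?leqW// -majE subr_eq0 -mulr_natr natz -PoszM eqz_nat.
by rewrite eq_sym [RHS]dvdn_eq.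
Qed.


Lemma vector_of_partition_in s : (cd w <= k)%N ->
  partitions_in_box p (k - cd w) s -> (p.+1 %| sumn s + maj w)%N ->
  cellini_vectors k w (vector_of_partition s).
Proof.
move=> cdk [ss _ sp sk] dvd; apply/cellini_vectorsP; split.
- by apply/eqP; rewrite vector_of_partition_sum.
- move=> i ip; rewrite !ffunE !inordK ?ltnS//; last exact: ltnW.
  have le_s : (nth 0%N s i.+1 <= nth 0%N s i)%N.
    have [si|si] := leqP (size s) i.+1; first by rewrite [nth _ _ i.+1]nth_default.
    exact: (sortedP 0%N ss) si.
  by rewrite (descs_fromS ip); lia.
- rewrite !ffunE /= descs_from_last (nth_default _ sp).
  have s0 : (nth 0%N s 0 <= k - cd w)%N.
    by case: s sk {ss sp dvd} => //= x s /andP[].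
  by move: s0 cdk; rewrite cdE; lia.
Qed.

(** The partition is read off as [u i = v i - v n - D i]: the inequalities make
    [u] weakly decreasing down to its last value zero, and the cyclic one bounds
    [u] by [k - cd w]. *)
Lemma vector_of_partition_onto v : cellini_vectors k w v ->
  exists2 s, partitions_in_box p (k - cd w) s
           & v = vector_of_partition s.
Proof.
move=> vk; have cdk := cd_le_of_vector vk.
have [sum0 dec wid] := (cellini_vectorsP v).1 vk.
pose u i : int := v (inord i) - v ord_max - (descs_from i)%:Z.
have inordp : inord p = ord_max :> 'I_p.+1 by apply: val_inj; rewrite /= inordK.
have inord0 : inord 0 = ord0 :> 'I_p.+1 by apply: val_inj; rewrite /= inordK.
have up : u p = 0 by rewrite /u inordp descs_from_last subrr.
have uS i : (i < p)%N -> u i.+1 <= u i.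
  by move=> ip; have := dec i ip; rewrite /u (descs_fromS ip); lia.
have u_ge0 i : (i <= p)%N -> 0 <= u i.
  move=> ip; rewrite -(subKn ip); elim: (p - i)%N => [|j IHj]; first by rewrite subn0 up.
  have [jp|pj] := ltnP j p; last by rewrite (_ : (p - j.+1 = p - j)%N)//; lia.
  have pjE : (p - j = (p - j.+1).+1)%N by lia.
  rewrite pjE in IHj.
  by apply: le_trans IHj (uS _ _); lia.
have u0 : u 0%N <= (k - cd w)%:Z.
  by move: wid cdk; rewrite /u inord0 cdE; lia.
have le_u0 i : (i <= p)%N -> u i <= u 0%N.
  by elim: i => [|i IHi] // ip; apply: le_trans (uS _ ip) (IHi (ltnW ip)).
pose t := mkseq (fun i => absz (u i)) p.
have nth_t i : (i <= p)%N -> (nth 0%N t i)%:Z = u i.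
  move=> ip; have [lt|le] := ltnP i p; first by rewrite nth_mkseq// gez0_abs// u_ge0.
  have -> : i = p by lia.
  by rewrite nth_default ?size_mkseq// up.
have st : sorted geq t.
  apply/(sortedP 0%N) => i; rewrite size_mkseq => ip.
  by have := uS i (ltnW ip); rewrite -!nth_t ?(ltnW ip)// ltnW// ltnW.
pose s := [seq x <- t | (0 < x)%N].
have nth_s i : nth 0%N s i = nth 0%N t i by apply: sorted_nth_filter_pos.
have sp : (size s <= p)%N.
  by rewrite size_filter (leq_trans (count_size _ _))// size_mkseq.
have vE i : v i = (nth 0%N s i + descs_from i)%:Z + v ord_max.
  rewrite PoszD nth_s nth_t -1?ltnS// /u inord_val; lia.
exists s.
  split=> //.
  - by apply: sorted_filter => // y x z /= xy yz; apply: leq_trans xy.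
  - exact: filter_all.
  - apply/allP => x; rewrite mem_filter => /andP[_ xt].
    have [i + <-] := nthP 0%N xt; rewrite size_mkseq => ip; rewrite nth_mkseq//.
    by have := u_ge0 i (ltnW ip); have := le_u0 i (ltnW ip); lia.
(* The constant [v ord_max] is forced, as all entries of [v] sum to zero. *)
have sumE : (sumn s + maj w)%:Z + p.+1%:Z * v ord_max = 0.
  rewrite -sum0; under eq_bigr do rewrite vE.
  rewrite big_split /= sumr_const card_ord -(big_morph Posz PoszD (erefl _)) big_split /=.
  by rewrite sum_nth0 ?leqW// -majE -[v _ *+ _]mulr_natl natz.
apply/ffunP => i; rewrite ffunE vE; congr (_ + _).
have majZ : (sumn s + maj w)%:Z = (absz (v ord_max) * p.+1)%:Z by nia.
have [->] := majZ; rewrite mulnK//.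
by nia.
Qed.

Lemma card_cellini_vectors :
  #|` fset_set (cellini_vectors k w)|
    = if (cd w <= k)%N
      then count (fun s => p.+1 %| sumn s + maj w)%N (box p (k - cd w)) else 0%N.
Proof.
case: ifP => [cdk|/negP cdk]; last first.
  apply/eqP; rewrite cardfs_eq0; apply/eqP/fsetP => v.
  rewrite in_fset_set ?in_fset0; last exact: finite_cellini_vectors.
  by apply/negP; rewrite inE => /cd_le_of_vector.
have boxP s : (s \in box p (k - cd w)) <-> partitions_in_box p (k - cd w) s.
  by rewrite mem_box; split => [/and4P[]|[*]]; last apply/and4P.
rewrite -size_filter -(size_map vector_of_partition); apply: card_fset_set_seq.
  rewrite map_inj_in_uniq ?filter_uniq ?box_uniq// => s t.
  rewrite !mem_filter => /andP[_ /boxP[_ s0 sp _]] /andP[_ /boxP[_ t0 tp _]].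
  by apply: vector_of_partition_inj; rewrite inE ?s0 ?sp ?t0 ?tp.
move=> v; split=> [vk|/mapP[s + ->]]; last first.
  by rewrite mem_filter => /andP[sn /boxP sb]; apply: vector_of_partition_in.
have [s sb vE] := vector_of_partition_onto vk; apply/mapP; exists s => //.
rewrite mem_filter (boxP s).2// andbT -vector_of_partition_sum; last by case: sb.
by rewrite -vE; case: vk => ->.
Qed.

End Vectors.

Theorem theorem1 (R : realType) (n k : nat) (w : 'S_n)
    (hn : (2 <= n)%N) (hk : (1 <= k)%N) :
  [/\ cellini n k w
        = (k%:R ^+ n.-1)^-1
          * (if (cd w <= k)%N
             then count_partitions n.-1 (k - cd w) n (- (maj w)%:Z)
             else 0%N)%:R,
      cellini n k w
        = (k%:R ^+ n.-1)^-1
          * (if (cd w <= k)%N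
             then count_partitions (k - cd w) n.-1 n (- (maj w)%:Z)
             else 0%N)%:R,
      ratr (cellini n k w) =
        (if (cd w < k)%N then
           (n%:R * k%:R ^+ n.-1)^-1
           * \sum_(d <- divisors n | (d %| k - cd w)%N)
               'C((n + (k - cd w) - d) %/ d, (k - cd w) %/ d)%:R
               * ramanujan_sum R d (- (maj w)%:Z)
         else if (k == cd w) && (n %| maj w)%N then (k%:R ^+ n.-1)^-1
         else 0 :> R[i])
    & cellini n k w
        = (k%:R ^+ n.-1)^-1
          * \sum_(r \in [set: nat])
              ('X^(maj w) * qbinom (k + n - cd w - 1) n.-1)`_(r * n)].
Proof.
have cellE : cellini n k w = (k%:R ^+ n.-1)^-1
    * (if (cd w <= k)%N then count (fun s => n %| sumn s + maj w)%N
         (box n.-1 (k - cd w)) else 0%N)%:R.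
  by case: n w hn => // p w _; rewrite /cellini ffunE card_cellini_vectors.
have n0 : (0 < n)%N := ltnW hn.
have cellE2 : cellini n k w = (k%:R ^+ n.-1)^-1
    * (if (cd w <= k)%N then count (fun s => n %| sumn s + maj w)%N
         (box (k - cd w) n.-1) else 0%N)%:R.
  by rewrite cellE; case: ifP => // _; rewrite count_box_sym.
split.
- by rewrite cellE count_partitionsE.
- by rewrite cellE2 count_partitionsE.
- have nR : (n%:R : R[i]) != 0 by rewrite pnatr_eq0 -lt0n.
  rewrite cellE2 rmorphM fmorphV rmorphXn /= !ratr_nat.
  case: (ltngtP (cd w) k) => cdk /=; last first.
  + rewrite cdk subnn /= addn0 add0n; case: (n %| maj w)%N; first by rewrite mulr1.
    by rewrite mulr0.
  + by rewrite mulr0.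
  (* The primitive root has a negative angle because the Ramanujan sum is
     taken at [- maj w]. *)
  rewrite -[X in _ * X](mulKf nR) (count_box_filter _ _ (expi_prim R n0)).
  rewrite invfM mulrA [_^-1 * n%:R^-1]mulrC; congr (_ * _).
  rewrite big_seq_cond [RHS]big_seq_cond; apply: eq_bigr => d /andP[+ _].
  rewrite -dvdn_divisors// => /dvdnP[e nE]; congr (_ * _); apply: eq_bigr => l _.
  have [e0 d0] : (0 < e)%N /\ (0 < d)%N by apply/andP; rewrite -muln_gt0 -nE.
  rewrite -expi_natmul {2}nE mulnK//; congr expi.
  have [eR dR] : (e%:R : R) != 0 /\ (d%:R : R) != 0 by rewrite !pnatr_eq0 -!lt0n.
  have nRE : (n%:R : R) = e%:R * d%:R by rewrite nE natrM.
  rewrite nRE -[_ *+ (l * e * _)]mulr_natr -[pi *+ 2]mulr_natl !natrM.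
  rewrite mulrNz -pmulrn; field.
  by rewrite eR dR.
- rewrite cellE2; case: ifP => cdk; last first.
    (* The truncated subtraction still gives an index below [n - 1]. *)
    rewrite fsbig1// => r _; rewrite /qbinom ifT ?mulr0 ?coef0//.
    by move/negP: cdk; lia.
  rewrite (_ : k + n - cd w - 1 = (k - cd w) + n.-1)%N; last by lia.
  by rewrite qbinom_gauss sum_coef_multiples.
Qed.
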